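(* For every positive integer $k$, \[m_e(\mathbb{B}_k,2)=k^2+2k+3 \quad\text{ and }\quad m(\mathbb{B}_k,2)=\left\lceil\frac{k^2+2k+3}{2}\right\rceil,\] where $\mathbb{B}_k$ is the bipartite odd graph on the ground set $\{1,\ldots,2k+1\}$.
   Context: All graphs are finite, undirected, without multiple edges or loops. Bipartite odd graph: for a positive integer $k$ let $M=\{1,\ldots,2k+1\}$. The graph $\mathbb{B}_k$ has as vertex set all $k$-subsets and all $(k+1)$-subsets of $M$; two vertices $S$ and $T$ are adjacent if $S\subsetneq T$ (or $T\subsetneq S$). $r$-neighbor bootstrap percolation: given a graph $G$, an integer $r\geqslant 0$ and a set $V_0\subseteq V(G)$ of initially active vertices, for each integer $i\geqslant 1$ let $V_i=V_{i-1}\cup\{v\in V(G) : v \text{ is adjacent to at least } r \text{ vertices in } V_{i-1}\}$. The set $V_0$ is a percolating set if $V_t=V(G)$ for some integer $t\geqslant 0$. $m(G,r)$ denotes the minimum cardinality of a percolating set in this process. $r$-edge bootstrap percolation: given a graph $G$, an integer $r\geqslant 0$ and a set $E_0\subseteq E(G)$ of initially active edges, for each integer $i\geqslant 1$ let $E_i=E_{i-1}\cup\{e\in E(G) : \text{at least one endpoint of } e \text{ is incident to at least } r \text{ edges in } E_{i-1}\}$. The set $E_0$ is a percolating set if $E_t=E(G)$ for some integer $t\geqslant 0$. $m_e(G,r)$ denotes the minimum cardinality of a percolating set in this process. *)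

(* Defs.v *)
From mathcomp Require Import all_boot.
From mathcomp Require Import boolp.

Set Implicit Arguments.
Unset Strict Implicit.
Unset Printing Implicit Defensive.

Record sgraph := SGraph {
  vertex :> finType;
  adj : rel vertex;
  adj_sym : symmetric adj;
  adj_irr : irreflexive adj
}.

Definition edges (G : sgraph) : {set {set G}} :=
  [set e : {set G} | [exists x, exists y, adj x y && (e == [set x; y])]].

Section Percolation.

Variables (G : sgraph) (r : nat).

Definition vertex_step (V : {set G}) : {set G} :=
  V :|: [set v : G | r <= #|[set w in V | adj v w]|].

Definition vertex_percolating (V0 : {set G}) : Prop :=
  exists t : nat, iter t vertex_step V0 = [set: G].

Definition edge_step (E : {set {set G}}) : {set {set G}} :=
  E :|: [set e in edges G | [exists x in e, r <= #|[set f in E | x \in f]|]].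

Definition edge_percolating (E0 : {set {set G}}) : Prop :=
  E0 \subset edges G /\ exists t : nat, iter t edge_step E0 = edges G.

Lemma vertex_percolating_setT : vertex_percolating [set: G].
Proof. by exists 0. Qed.

Lemma edge_percolating_edges : edge_percolating (edges G).
Proof. by split=> //; exists 0. Qed.

(* The default value of each [arg min ...] is itself percolating, by the two
   lemmas above, so the default never stands in for a missing minimum. *)
Definition m : nat :=
  #|[arg min_(V < [set: G] | `[< vertex_percolating V >]) #|V|]|.

Definition m_e : nat :=
  #|[arg min_(E < edges G | `[< edge_percolating E >]) #|E|]|.

Lemma m_spec : (exists2 V, vertex_percolating V & #|V| = m) /\
  forall V, vertex_percolating V -> m <= #|V|.
Proof.
rewrite /m; case: arg_minnP => [|V /asboolP perV minV].
  exact/asboolP/vertex_percolating_setT.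
by split=> [|W perW]; [exists V | apply/minV/asboolP].
Qed.

Lemma m_e_spec : (exists2 E, edge_percolating E & #|E| = m_e) /\
  forall E, edge_percolating E -> m_e <= #|E|.
Proof.
rewrite /m_e; case: arg_minnP => [|E /asboolP perE minE].
  exact/asboolP/edge_percolating_edges.
by split=> [|F perF]; [exists E | apply/minE/asboolP].
Qed.

End Percolation.

Section BipartiteOddGraph.

Variable k : nat.

(* The ground set {1, ..., 2k+1} is encoded as 'I_(2 * k + 1). *)
Definition bog_vertex : finType :=
  {S : {set 'I_(2 * k + 1)} | (#|S| == k) || (#|S| == k.+1)}.

Definition bog_adj : rel bog_vertex :=
  fun S T => (val S \proper val T) || (val T \proper val S).

Lemma bog_adj_sym : symmetric bog_adj.
Proof. by move=> S T; rewrite /bog_adj orbC. Qed.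

Lemma bog_adj_irr : irreflexive bog_adj.
Proof. by move=> S; rewrite /bog_adj properxx. Qed.

Definition bipartite_odd_graph : sgraph := SGraph bog_adj_sym bog_adj_irr.

End BipartiteOddGraph.

(* Main.v *)
Require Import Defs.
From HB Require Import structures.
From mathcomp Require Import all_boot all_algebra ring zify.

(** Both upper bounds come from one construction and both lower bounds from one
    rank computation.

    Lower bounds.  Attach to the edge between [S] and [T = x |: S] the polynomial
    [P_T(y) P_(~: S)(z)], where [P_A] is the product of the [X - t_i] over [i] in
    [A], for distinct nodes [t_i].  The edges at [S] carry multiples of
    [P_S(y) P_(~: S)(z)] by the linear factors [y - t_x], and the edges at [T]
    multiples of [P_T(y) P_(~: T)(z)] by the [z - t_x]; so any two edges at a
    vertex span all edges at that vertex, the span of the active edges never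
    grows, and a percolating set of edges has at least as many elements as the
    rank of the whole family ([edge_percolating_span]).  That rank is
    [(k + 1)^2 + 2] ([tensors_rank]).  The span contains
    [(y - z) P_S(y) P_U(z)] for all disjoint [k]-sets [S] and [U].  These
    products [P_S(y) P_U(z)] span all polynomials of degree at most [k] in each
    variable ([disjoint_tensors_span]), which gives dimension [(k + 1)^2] inside
    the multiples of [y - z]; restriction to the diagonal [y = z] gives the two
    further dimensions.  For vertices, activating two edges at each vertex
    of a percolating set gives a percolating set of edges, hence
    [m_e <= 2 m] ([m_e_le_rm]).

    Upper bounds.  Work in an interval [[L, R]] of the Boolean lattice with
    [#|R| = #|L| + 2 j + 1], whose two middle levels form a copy of the graph for
    [j], and induct on [j] ([percolating_seeds]).  Two elements [a], [b] of the
    interval cut it in four.  The sets with [a] and without [b] form a copy for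
    [j - 1]; once they are active, the upper sets of the part with both elements
    and the lower sets of the part with neither have one active neighbour
    outside their part, so each of these two parts costs only about [j / 2] more
    vertices ([lower_seeds], [upper_seeds]).  Then every set with [b] and without
    [a] has an active neighbour, and a single active one spreads to all
    ([middle_connected]).  Counting an active vertex as two active edges, the
    step costs [2 j + 1] edges, which is odd; so for even [j] the invariant
    keeps a half vertex, that needs only one active neighbour, standing for a
    single active edge. *)

Set Implicit Arguments.
Unset Strict Implicit.
Unset Printing Implicit Defensive.

(** * Finite sets *)

(** Counting steps depend on the cardinality hypotheses alone. *)
Ltac card_lia :=
  repeat match goal with
  | H : is_true (_ \subset _) |- _ => clear H
  | H : is_true (_ \in _) |- _ => clear H
  | H : is_true (_ \notin _) |- _ => clear H
  | H : is_true (_ != _) |- _ => clear H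
  | H : forall _, _ |- _ => clear H
  end; lia.

Lemma setU1_inj (T : finType) (S : {set T}) x y :
  x \notin S -> x |: S = y |: S -> x = y.
Proof.
by move=> nSx /setP/(_ x); rewrite !inE eqxx (negbTE nSx) /= orbF => /esym/eqP.
Qed.

Lemma setD1_inj (T : finType) (S : {set T}) x y :
  x \in S -> S :\ x = S :\ y -> x = y.
Proof.
by move=> Sx /setP/(_ x); rewrite !inE eqxx Sx /= andbT => /esym/negbFE/eqP.
Qed.

Lemma cardsU1_eq (T : finType) (S : {set T}) x n :
  #|S| = n -> x \notin S -> #|x |: S| = n.+1.
Proof. by move=> <- nSx; rewrite cardsU1 nSx. Qed.

Lemma cardsD1_eq (T : finType) (S : {set T}) x n :
  #|S| = n.+1 -> x \in S -> #|S :\ x| = n.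
Proof. by move=> cardS Sx; have := cardsD1 x S; rewrite Sx cardS => -[]. Qed.

Lemma ex_subset_card (T : finType) (D : {set T}) n : n <= #|D| ->
  exists2 A : {set T}, A \subset D & #|A| = n.
Proof.
case/card_geqP=> s [uniq_s <- sD]; exists [set x in s].
  by apply/subsetP=> x; rewrite inE => /sD.
by rewrite cardsE; apply/card_uniqP.
Qed.

Lemma disjoint_setU1s (T : finType) (A B : {set T}) a b :
    [disjoint A & B] -> a \notin B -> b \notin A -> a != b ->
  [disjoint a |: A & b |: B].
Proof.
move=> dAB nBa nAb neq_ab; rewrite disjoints_subset; apply/subsetP=> i.
rewrite !inE negb_or => /predU1P[->|Ai]; first by rewrite neq_ab.
by rewrite (disjointFr dAB Ai) andbT; apply: contraNneq nAb => <-.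
Qed.

Lemma ex_set_between (T : finType) (L R : {set T}) n :
    L \subset R -> #|L| <= n <= #|R| ->
  exists S : {set T}, [/\ L \subset S, S \subset R & #|S| = n].
Proof.
move=> sLR /andP[leLn lenR].
have [|D sD cardD] := @ex_subset_card _ (R :\: L) (n - #|L|).
  by rewrite cardsD (setIidPr sLR) leq_sub2r.
have /subsetDP[sDR dDL] := sD.
exists (L :|: D); split; rewrite ?subsetUl ?subUset ?sLR //.
by rewrite cardsU setIC disjoint_setI0 // cards0 cardD; lia.
Qed.

(** * Percolation in a graph *)

(** Each step that is not stationary decreases the complement, so a fixed point is
    reached and percolation can be tested on closed sets instead of iterates. *)
Lemma iter_extensive_fixed (T : finType) (f : {set T} -> {set T}) (A : {set T}) :
  (forall B : {set T}, B \subset f B) -> exists t, f (iter t f A) = iter t f A.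
Proof.
move=> ext_f; have [n] := ubnP #|~: A|; elim: n A => // n IHn A leAn.
have [fixA|/eqP nfixA] := eqVneq (f A) A; first by exists 0.
have /proper_card: ~: f A \proper ~: A.
  rewrite properE !setCS ext_f /=; apply/negP=> sfA.
  by apply: nfixA; apply/eqP; rewrite eqEsubset sfA ext_f.
move=> /leq_trans/(_ leAn)/IHn[t fix_t].
by exists t.+1; rewrite iterSr.
Qed.

Section Graph.

Variables (G : sgraph) (r : nat).
Implicit Types (v w : G) (V : {set G}) (e : {set G}) (E : {set {set G}}).

Lemma edgesP e :
  reflect (exists v w, adj v w /\ e = [set v; w]) (e \in edges G).
Proof.
rewrite inE; apply: (iffP existsP) => [[v /existsP[w /andP[vw /eqP ->]]]|].
  by exists v, w.
by case=> v [w [vw ->]]; exists v; apply/existsP; exists w; rewrite vw eqxx.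
Qed.

Lemma edge_stepS E E' : E \subset E' -> edge_step r E \subset edge_step r E'.
Proof.
move=> sEE'; apply: setUSS => //; apply/subsetP=> e; rewrite !inE.
case/andP=> -> /existsP[v /andP[ve rv]]; apply/existsP; exists v.
rewrite ve (leq_trans rv) ?subset_leq_card //; apply/subsetP=> f.
by rewrite !inE => /andP[/(subsetP sEE') -> ->].
Qed.

Lemma edge_step_edges E : E \subset edges G -> edge_step r E \subset edges G.
Proof.
move=> sE; rewrite subUset sE /=; apply/subsetP=> e.
by rewrite inE => /andP[].
Qed.

Lemma vertex_stepS V V' : V \subset V' -> vertex_step r V \subset vertex_step r V'.
Proof.
move=> sVV'; apply: setUSS => //; apply/subsetP=> v; rewrite !inE => rv.
rewrite (leq_trans rv) ?subset_leq_card //; apply/subsetP=> w.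
by rewrite !inE => /andP[/(subsetP sVV') -> ->].
Qed.

(** The step is monotone and extensive, so the final active set is the least closed
    set above the initial one. *)
Lemma vertex_percolatingP V0 :
  vertex_percolating r V0 <->
  (forall V, V0 \subset V -> vertex_step r V \subset V -> V = [set: G]).
Proof.
split=> [[t tV0] V sV0V closedV | minV0].
  apply/eqP; rewrite eqEsubset subsetT -tV0.
  elim: t {tV0} => //= t IHt.
  exact: subset_trans (vertex_stepS IHt) closedV.
have ext V : V \subset vertex_step r V by apply: subsetUl.
have [t fix_t] := iter_extensive_fixed V0 ext.
exists t; apply: minV0; last by rewrite fix_t.
by elim: t {fix_t} => //= t /subset_trans; apply.
Qed.

Lemma edge_percolatingP E0 : E0 \subset edges G ->
  edge_percolating r E0 <->
  (forall E, E0 \subset E -> E \subset edges G -> edge_step r E \subset E ->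
     E = edges G).
Proof.
move=> sE0; split=> [[_ [t tE0]] E sE0E sEG closedE | minE0].
  apply/eqP; rewrite eqEsubset sEG -tE0.
  elim: t {tE0} => //= t IHt.
  exact: subset_trans (edge_stepS IHt) closedE.
split=> //; have ext E : E \subset edge_step r E by apply: subsetUl.
have [t fix_t] := iter_extensive_fixed E0 ext.
exists t; apply: minE0; last by rewrite fix_t.
  by elim: t {fix_t} => //= t /subset_trans; apply.
by elim: t {fix_t} => //= t /edge_step_edges.
Qed.

Definition star v : {set {set G}} := [set e in edges G | v \in e].

Definition saturated E : {set G} := [set v | star v \subset E].

Lemma saturated_degree E v : edge_step r E \subset E ->
  r <= #|[set e in E | v \in e]| -> v \in saturated E.
Proof.
move=> closedE rv; rewrite inE; apply/subsetP=> e; rewrite inE => /andP[eG ve].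
apply: (subsetP closedE); rewrite inE; apply/orP; right.
by rewrite inE eG; apply/existsP; exists v; rewrite ve.
Qed.

Lemma mem_star v w : adj v w -> [set v; w] \in star v.
Proof.
by move=> vw; rewrite inE set21 andbT; apply/edgesP; exists v, w.
Qed.

Lemma edge_set2_inj v w w' : adj v w -> [set v; w] = [set v; w'] -> w = w'.
Proof.
move=> vw /setP/(_ w); rewrite !inE eqxx orbT; case: eqP => [wv|_ /esym/eqP //].
by rewrite wv adj_irr in vw.
Qed.

(** Saturation turns the edge process into the vertex process: [r] saturated
    neighbours of a vertex give [r] distinct active edges at it. *)
Lemma saturated_closed E : edge_step r E \subset E ->
  vertex_step r (saturated E) \subset saturated E.
Proof.
move=> closedE; rewrite subUset subxx /=; apply/subsetP=> v; rewrite inE => rv.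
apply: saturated_degree closedE _; apply: leq_trans rv _.
rewrite -(@card_in_imset _ _ (fun w => [set v; w])).
  apply/subset_leq_card/subsetP=> _ /imsetP[w + ->].
  rewrite !inE eqxx andbT => /andP[/subsetP sw vw]; apply: sw.
  by rewrite setUC mem_star // adj_sym.
by move=> w w'; rewrite !inE => /andP[_ vw] _; apply: edge_set2_inj.
Qed.

Lemma saturatedT E : E \subset edges G -> saturated E = [set: G] ->
  E = edges G.
Proof.
move=> sE satE; apply/eqP; rewrite eqEsubset sE; apply/subsetP=> e eG.
have [v [w [vw def_e]]] := edgesP _ eG.
have: v \in saturated E by rewrite satE inE.
by rewrite inE def_e => /subsetP; apply; apply: mem_star.
Qed.

Lemma card_star v : #|star v| = #|[set w | adj v w]|.
Proof.
rewrite -(@card_in_imset _ _ (fun w => [set v; w]) [set w | adj v w]).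
  apply/eq_card => e; apply/idP/imsetP=> [|[w + ->]]; last first.
    by rewrite inE => /mem_star.
  rewrite inE => /andP[/edgesP[x [y [xy ->]]]].
  rewrite !inE => /orP[]/eqP->; first by exists y; rewrite ?inE.
  by exists x; rewrite ?inE 1?adj_sym // setUC.
by move=> w w'; rewrite inE => vw _; apply: edge_set2_inj.
Qed.

Lemma star_cover V0 : (forall v, r <= #|[set w | adj v w]|) ->
  exists E0, [/\ E0 \subset edges G, #|E0| <= r * #|V0| &
    forall v, v \in V0 -> r <= #|[set e in E0 | v \in e]|].
Proof.
move=> degG; pose F v := [set e in take r (enum (star v))].
have sF v e : e \in F v -> e \in star v.
  by rewrite inE => /mem_take; rewrite mem_enum.
have cardF v : #|F v| = r.
  rewrite cardsE (card_uniqP _) ?take_uniq ?enum_uniq //.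
  by rewrite size_takel // -cardE card_star.
exists (\bigcup_(v in V0) F v); split.
- by apply/bigcupsP=> v _; apply/subsetP=> e /sF; rewrite inE => /andP[].
- rewrite mulnC -sum_nat_const; elim/big_rec2: _ => [|v n E _ leEn].
    by rewrite cards0.
  by rewrite (leq_trans (leq_card_setU _ _)) // cardF leq_add2l.
move=> v V0v; rewrite -{1}(cardF v) subset_leq_card //; apply/subsetP=> e Fe.
have:= sF _ _ Fe; rewrite !inE => /andP[_ ->]; rewrite andbT.
by apply/bigcupP; exists v.
Qed.

(** The [r] edges chosen at each vertex of an optimal [V0] saturate [V0], and the
    vertices saturated by a closed set of edges are closed under the vertex
    process. *)
Lemma m_e_le_rm : (forall v, r <= #|[set w | adj v w]|) ->
  m_e G r <= r * m G r.
Proof.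
move=> degG; have [[V0 percV0 <-] _] := m_spec G r.
have [_ min_e] := m_e_spec G r.
have [E0 [sE0 cardE0 degE0]] := star_cover V0 degG.
apply: leq_trans cardE0; apply/min_e/edge_percolatingP => // E sE0E sE closedE.
apply: saturatedT => //.
apply: (proj1 (vertex_percolatingP V0) percV0) (saturated_closed closedE).
apply/subsetP=> v /degE0 rv; apply: saturated_degree => //.
apply: leq_trans rv _; apply/subset_leq_card/subsetP=> e.
by rewrite !inE => /andP[/(subsetP sE0E) -> ->].
Qed.

(** Weak saturation by linear algebra: the edges with weight in the span [X] of the
    initial weights form a closed set, since an edge is activated by [r] edges of [X]
    at one of its endpoints, whose weights span its own. *)
Lemma edge_percolating_span (F : fieldType) (vT : vectType F)
    (q : {set G} -> vT) E0 :
    (forall v E e, E \subset star v -> r <= #|E| -> e \in star v ->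
       q e \in <<[seq q f | f <- enum E]>>%VS) ->
    edge_percolating r E0 ->
  exists2 X : {vspace vT}, \dim X <= #|E0| &
    forall e, e \in edges G -> q e \in X.
Proof.
move=> spanq percE0; have sE0 := percE0.1.
pose X := <<[seq q f | f <- enum E0]>>%VS; exists X.
  by rewrite (leq_trans (dim_span _)) // size_map -cardE.
pose E := [set e in edges G | q e \in X].
suff defE: E = edges G by move=> e; rewrite -defE inE => /andP[].
apply: (proj1 (edge_percolatingP sE0) percE0).
- apply/subsetP=> e E0e; rewrite inE (subsetP sE0) // memv_span //.
  by rewrite map_f ?mem_enum.
- by apply/subsetP=> e; rewrite inE => /andP[].
rewrite subUset subxx /=; apply/subsetP=> e; rewrite inE.
case/andP=> eG /existsP[v /andP[ve rv]]; rewrite inE eG /=.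
have:= spanq v [set f in E | v \in f] e; rewrite rv inE eG ve => /(_ _ isT isT).
have sEv : [set f in E | v \in f] \subset star v.
  by apply/subsetP=> f; rewrite !inE => /andP[/andP[-> _] ->].
move=> /(_ sEv); apply/subvP/span_subvP=> _ /mapP[f + ->].
by rewrite mem_enum !inE => /andP[/andP[]].
Qed.

End Graph.
(** * Bivariate polynomials *)

Section BivariatePolynomials.

Import GRing.Theory.
Local Open Scope ring_scope.

Variable F : fieldType.

(** The coefficient matrix of [p(y) q(z)], truncated to degree less than [n] in each
    variable.  Matrices make bivariate polynomials a finite-dimensional space. *)
Definition tensor n (p q : {poly F}) : 'M[F]_n := (poly_rV p)^T *m poly_rV q.

(** The value at [y = z = w]. *)
Definition diag_eval n (w : F) (A : 'M[F]_n) : F :=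
  \sum_i \sum_j A i j * (w ^+ i * w ^+ j).

Fact diag_eval_is_linear n w : linear (@diag_eval n w : _ -> F^o).
Proof.
move=> a A B; rewrite /diag_eval scaler_sumr -big_split /=.
apply: eq_bigr => i _; rewrite scaler_sumr -big_split /=.
by apply: eq_bigr => j _; rewrite !mxE mulrDl -mulrA.
Qed.

HB.instance Definition _ n w :=
  GRing.isLinear.Build F 'M[F]_n F^o _ (@diag_eval n w) (@diag_eval_is_linear n w).

Definition shift_mx n : 'M[F]_(n.+1, n) := \matrix_(i, j) (i == j.+1 :> nat)%:R.
Definition widen_mx n : 'M[F]_(n.+1, n) := \matrix_(i, j) (i == j :> nat)%:R.

(** Multiplication by [y - z]. *)
Definition mul_diff n (A : 'M[F]_n) : 'M[F]_n.+1 :=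
  shift_mx n *m A *m (widen_mx n)^T - widen_mx n *m A *m (shift_mx n)^T.

Fact mul_diff_is_linear n : linear (@mul_diff n).
Proof.
move=> a A B; rewrite /mul_diff !mulmxDr !mulmxDl -!scalemxAr -!scalemxAl.
by rewrite scalerBr opprD addrACA.
Qed.

HB.instance Definition _ n :=
  GRing.isLinear.Build F 'M[F]_n 'M[F]_n.+1 _ (@mul_diff n) (@mul_diff_is_linear n).

Lemma tensorE n p q (i j : 'I_n) : tensor n p q i j = p`_i * q`_j.
Proof. by rewrite mxE big_ord1 !mxE. Qed.

Lemma tensorBl n p p' q : tensor n (p - p') q = tensor n p q - tensor n p' q.
Proof. by rewrite /tensor linearB /= linearB mulmxBl. Qed.

Lemma tensorBr n p q q' : tensor n p (q - q') = tensor n p q - tensor n p q'.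
Proof. by rewrite /tensor linearB mulmxBr. Qed.

Lemma tensorZl n a p q : tensor n (a *: p) q = a *: tensor n p q.
Proof. by rewrite /tensor linearZ /= linearZ /= scalemxAl. Qed.

Lemma tensorZr n a p q : tensor n p (a *: q) = a *: tensor n p q.
Proof. by rewrite /tensor linearZ /= scalemxAr. Qed.

Lemma diag_eval_tensor n w (p q : {poly F}) : (size p <= n)%N -> (size q <= n)%N ->
  diag_eval w (tensor n p q) = p.[w] * q.[w].
Proof.
move=> sp sq; rewrite (horner_coef_wide _ sp) (horner_coef_wide _ sq).
rewrite big_distrlr /=; apply: eq_bigr => i _; apply: eq_bigr => j _.
by rewrite tensorE mulrACA.
Qed.

Lemma shift_mx_rV n (p : {poly F}) : (size p <= n)%N ->
  shift_mx n *m (poly_rV p)^T = (poly_rV ('X * p))^T :> 'cV_n.+1.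
Proof.
move=> sp; apply/colP=> i; rewrite !mxE coefXM.
under eq_bigr do rewrite !mxE mulrC mulr_natr mulrb.
case: i => -[|i] /= lt_in; first by rewrite big1.
by rewrite -big_mkcond /= (big_pred1 (Ordinal (lt_in : (i < n)%N))).
Qed.

Lemma widen_mx_rV n (p : {poly F}) : (size p <= n)%N ->
  widen_mx n *m (poly_rV p)^T = (poly_rV p)^T :> 'cV_n.+1.
Proof.
move=> sp; apply/colP=> i; rewrite !mxE.
under eq_bigr do rewrite !mxE mulrC mulr_natr mulrb.
rewrite -big_mkcond /=; have [lt_in|le_ni] := ltnP i n.
  by rewrite (big_pred1 (Ordinal lt_in)).
rewrite nth_default ?(leq_trans sp) // big1 // => j /eqP ij.
by rewrite ij leqNgt ltn_ord in le_ni.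
Qed.

Lemma mul_diff_tensor n (p q : {poly F}) : (size p <= n)%N -> (size q <= n)%N ->
  mul_diff (tensor n p q) = tensor n.+1 ('X * p) q - tensor n.+1 p ('X * q).
Proof.
move=> sp sq; rewrite /mul_diff /tensor !mulmxA shift_mx_rV // widen_mx_rV //.
have tr (B : 'M[F]_(n.+1, n)) : poly_rV q *m B^T = (B *m (poly_rV q)^T)^T.
  by rewrite trmx_mul trmxK.
by rewrite -!mulmxA !tr widen_mx_rV // shift_mx_rV // !trmxK.
Qed.

Lemma diag_evalE n w (A : 'M[F]_n) (u := \row_i w ^+ i) :
  diag_eval w A = (u *m A *m u^T) 0 0.
Proof.
rewrite mxE /diag_eval exchange_big /=; apply: eq_bigr => j _.
rewrite !mxE mulr_suml; apply: eq_bigr => i _; rewrite !mxE.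
by rewrite mulrA [w ^+ i * _]mulrC.
Qed.

Lemma diag_eval_mul_diff n w (A : 'M[F]_n) : diag_eval w (mul_diff A) = 0.
Proof.
rewrite diag_evalE; set u := \row_i _.
pose v : 'rV[F]_n := \row_i w ^+ i.
have us : u *m shift_mx n = w *: v.
  apply/rowP=> j; rewrite !mxE (bigD1 (lift ord0 j)) //= !mxE eqxx mulr1 -exprS.
  rewrite big1 ?addr0 // => i; rewrite -val_eqE !mxE /= => /negbTE->.
  by rewrite mulr0.
have uw : u *m widen_mx n = v.
  apply/rowP=> j; rewrite !mxE (bigD1 (widen_ord (leqnSn n) j)) //=.
  rewrite !mxE eqxx mulr1.
  rewrite big1 ?addr0 // => i; rewrite -val_eqE !mxE /= => /negbTE->.
  by rewrite mulr0.
rewrite /mul_diff mulmxBr mulmxBl !mulmxA us uw -!mulmxA -!trmx_mul us uw.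
by rewrite -!scalemxAl linearZ /= -!scalemxAr subrr mxE.
Qed.

(** The [(i, j + 1)] coefficient of [(y - z) A] is [A_(i-1, j+1) - A_(i, j)], so the
    rows of [A] vanish one after the other; entries outside [A] count as zero. *)
Lemma mul_diff_eq0 n (A : 'M[F]_n) : mul_diff A = 0 -> A = 0.
Proof.
move=> A0; suff zA m (i j : 'I_n) : (i < m)%N -> A i j = 0.
  by apply/matrixP=> i j; rewrite mxE (zA n).
elim: m i j => // m IHm i j lt_im.
set x := widen_ord (leqnSn n) i; set y := lift ord0 j.
have Axy : (shift_mx n *m A *m (widen_mx n)^T) x y = 0.
  rewrite mxE big1 // => j' _; rewrite !mxE mulr_suml big1 // => i' _.
  rewrite !mxE; have [/= def_i|] := eqP; last by rewrite !mul0r.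
  by rewrite IHm ?mulr0 ?mul0r // -ltnS -def_i.
have <- : (widen_mx n *m A *m (shift_mx n)^T) x y = A i j.
  rewrite mxE (bigD1 j) //= !mxE eqxx mulr1 (bigD1 i) //= !mxE eqxx mul1r.
  rewrite !big1 ?addr0 // => [j' | i']; rewrite -val_eqE !mxE /= eq_sym => /negbTE.
    by rewrite eqSS => ->; rewrite mulr0.
  by move=> ->; rewrite mul0r.
apply/eqP; rewrite -oppr_eq0 -{1}[- _]add0r -{1}Axy; apply/eqP.
by move/matrixP/(_ x y): A0; rewrite /mul_diff !mxE.
Qed.

(** The two contributions are independent because multiples of [y - z] vanish on the
    diagonal: [n ^ 2] counts the multiples, which lie in the kernel of the evaluation
    at the diagonal points [w], and [s] is the rank of this evaluation on [X]. *)
Lemma dim_diff_ideal n s (w : 'I_s -> F) (X : {vspace 'M[F]_n.+1}) :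
    (forall A, mul_diff A \in X) ->
    (forall i : 'I_s, exists2 B, B \in X &
       forall j, (diag_eval (w j) B != 0) = (j == i)) ->
  (n ^ 2 + s <= \dim X)%N.
Proof.
move=> idealX evX.
pose f : 'Hom('M[F]_n, 'M[F]_n.+1) := linfun (@mul_diff n).
pose ev (B : 'M[F]_n.+1) : 'rV[F]_s := \row_j diag_eval (w j) B.
have ev_lin : linear ev.
  by move=> a B C; apply/rowP=> j; rewrite !mxE linearP.
pose evL := GRing.isLinear.Build _ _ _ _ ev ev_lin.
pose g : 'Hom('M[F]_n.+1, 'rV[F]_s) := linfun (HB.pack ev evL : {linear _ -> _}).
rewrite -(limg_ker_dim g X) leq_add //.
  have <- : \dim (limg f) = (n ^ 2)%N.
    rewrite limg_dim_eq ?dimvf ?dim_matrix // capfv.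
    apply/eqP; rewrite -subv0; apply/subvP=> A; rewrite memv_ker memv0 lfunE.
    by move=> /eqP/mul_diff_eq0->.
  apply/dimvS/subvP=> _ /memv_imgP[A _ ->]; rewrite memv_cap lfunE idealX.
  rewrite memv_ker lfunE; apply/eqP/rowP=> j.
  by rewrite !mxE diag_eval_mul_diff.
have -> : (g @: X)%VS = fullv.
  apply/eqP; rewrite eqEsubv subvf; apply/subvP=> u _.
  rewrite [u]row_sum_delta memv_suml // => i _; apply: memvZ.
  have [B XB evB] := evX i; have := evB i; rewrite eqxx => Bi.
  have -> : delta_mx 0 i = (diag_eval (w i) B)^-1 *: g B.
    apply/rowP=> j; rewrite lfunE !mxE eqxx /=.
    have := evB j; case: (j =P i) => [-> _|_ /negbFE/eqP ->]; last by rewrite mulr0.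
    by rewrite mulVf.
  by rewrite memvZ ?memv_img.
by rewrite dimvf dim_matrix [X in (_ <= X)%N]mul1r.
Qed.

(** Two distinct monic linear factors span all polynomials of degree at most one. *)
Lemma pencil_l n (X : {vspace 'M[F]_n}) a b p q : a != b ->
    tensor n (('X - a%:P) * p) q \in X -> tensor n (('X - b%:P) * p) q \in X ->
  tensor n p q \in X /\ forall c, tensor n (('X - c%:P) * p) q \in X.
Proof.
move=> neq_ab Xa Xb; have Xpq : tensor n p q \in X.
  rewrite -[_ \in X]orFb -(negbTE neq_ab) -subr_eq0 -rpredZeq -tensorZl.
  suff -> : (a - b) *: p = ('X - b%:P) * p - ('X - a%:P) * p.
    by rewrite tensorBl rpredB.
  by rewrite -mul_polyC polyCB; ring.
split=> // c.
suff -> : ('X - c%:P) * p = ('X - a%:P) * p - (c - a) *: p.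
  by rewrite tensorBl tensorZl rpredB ?rpredZ.
by rewrite -mul_polyC polyCB; ring.
Qed.

Lemma pencil_r n (X : {vspace 'M[F]_n}) a b p q : a != b ->
    tensor n p (('X - a%:P) * q) \in X -> tensor n p (('X - b%:P) * q) \in X ->
  tensor n p q \in X /\ forall c, tensor n p (('X - c%:P) * q) \in X.
Proof.
move=> neq_ab Xa Xb; have Xpq : tensor n p q \in X.
  rewrite -[_ \in X]orFb -(negbTE neq_ab) -subr_eq0 -rpredZeq -tensorZr.
  suff -> : (a - b) *: q = ('X - b%:P) * q - ('X - a%:P) * q.
    by rewrite tensorBr rpredB.
  by rewrite -mul_polyC polyCB; ring.
split=> // c.
suff -> : ('X - c%:P) * q = ('X - a%:P) * q - (c - a) *: q.
  by rewrite tensorBr tensorZr rpredB ?rpredZ.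
by rewrite -mul_polyC polyCB; ring.
Qed.

Lemma tensor_swap_factor n a (p q : {poly F}) : (size p <= n)%N -> (size q <= n)%N ->
  tensor n.+1 (('X - a%:P) * p) q - tensor n.+1 p (('X - a%:P) * q) =
    mul_diff (tensor n p q).
Proof.
move=> sp sq; rewrite mul_diff_tensor // !mulrBl tensorBl tensorBr !mul_polyC.
by rewrite tensorZl tensorZr opprB addrA subrK.
Qed.

(** This is [(y - a)(z - b) - (y - b)(z - a) = (a - b)(y - z)], the identity that
    brings [y - z] into the span of the products of node polynomials. *)
Lemma tensor_swap_factors n a b (p q : {poly F}) :
    (size p <= n)%N -> (size q <= n)%N ->
  tensor n.+1 (('X - a%:P) * p) (('X - b%:P) * q) -
    tensor n.+1 (('X - b%:P) * p) (('X - a%:P) * q) =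
  (a - b) *: mul_diff (tensor n p q).
Proof.
move=> sp sq; rewrite mul_diff_tensor // !mulrBl !tensorBl !tensorBr !mul_polyC.
rewrite !tensorZl !tensorZr; apply/matrixP=> i j; rewrite !mxE; ring.
Qed.

Section Nodes.

Variables (I : finType) (t : I -> F).
Hypothesis inj_t : injective t.

Definition node_poly (A : {set I}) : {poly F} := \prod_(i in A) ('X - (t i)%:P).

Implicit Types (A B S T M : {set I}).

Lemma size_node_poly A : size (node_poly A) = #|A|.+1.
Proof. by rewrite /node_poly -big_enum size_prod_XsubC -cardE. Qed.

Lemma root_node_poly A i : root (node_poly A) (t i) = (i \in A).
Proof.
rewrite /node_poly -big_enum /= -(big_map t xpredT (fun c => 'X - c%:P)).
by rewrite root_prod_XsubC mem_map // mem_enum.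
Qed.

Lemma node_polyU1 A i : i \notin A ->
  node_poly (i |: A) = ('X - (t i)%:P) * node_poly A.
Proof. exact: big_setU1. Qed.

(** Exchanging [a] in [A] with [b] in [B] shows, by [tensor_swap_factors], that [X]
    contains [(y - z)] times the same family for the set [M] without [a] and [b]; by
    induction [X] contains all multiples of [y - z].  On the diagonal the product for
    a partition of [M] minus one point vanishes at all nodes of [M] except that
    point, so the evaluation at the nodes of [M] has full rank on [X], and
    [(k + 1)^2 + (2 k + 3) = (k + 2)^2] is the dimension of the whole space. *)
Lemma disjoint_tensors_span k M (X : {vspace 'M[F]_k.+1}) :
    #|M| = (2 * k).+1 ->
    (forall A B, A :|: B \subset M -> [disjoint A & B] -> #|A| = k -> #|B| = k ->
       tensor k.+1 (node_poly A) (node_poly B) \in X) ->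
  forall C, C \in X.
Proof.
elim: k M X => [|k IHk] M X cardM tensX C.
  have -> : C = C 0 0 *: tensor 1 (node_poly set0) (node_poly set0).
    apply/matrixP=> i j; rewrite !ord1 mxE tensorE /node_poly big_set0.
    by rewrite coef1 !mulr1.
  by rewrite memvZ // tensX ?setU0 ?sub0set ?cards0 // -setI_eq0 setI0.
have /card_gt1P[a [b [Ma Mb neq_ab]]] : (1 < #|M|)%N by rewrite cardM.
pose M' := M :\ a :\ b.
have cardM' : #|M'| = (2 * k).+1.
  have := cardsD1 a M; have := cardsD1 b (M :\ a).
  by rewrite -/M' Ma cardM !inE eq_sym neq_ab Mb /=; lia.
(* Exchanging a and b between the two factors reduces to M'. *)
have idealX D : mul_diff D \in X.
  have := IHk M' (linfun (@mul_diff k.+1) @^-1: X)%VS cardM' _ D.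
  rewrite -memv_preim lfunE; apply=> A B sAB dAB cardA cardB.
  rewrite -memv_preim lfunE /=.
  have sABM : A :|: B \subset M.
    by rewrite (subset_trans sAB) // /M' (subset_trans (subsetDl _ _)) ?subsetDl.
  have notAB i : i \notin M' -> (i \notin A) && (i \notin B).
    move=> nM'i; rewrite -negb_or -in_setU.
    by apply: contra nM'i; apply: (subsetP sAB).
  have /andP[nAa nBa] : (a \notin A) && (a \notin B).
    by apply: notAB; rewrite !inE eqxx andbF.
  have /andP[nAb nBb] : (b \notin A) && (b \notin B).
    by apply: notAB; rewrite !inE eqxx.
  have neq_tab : t a - t b != 0 by rewrite subr_eq0 (inj_eq inj_t).
  rewrite -[_ \in X]orFb -(negbTE neq_tab) -rpredZeq.
  rewrite -tensor_swap_factors ?size_node_poly ?cardA ?cardB //.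
  rewrite -!node_polyU1 //.
  have [sAM sBM] : A \subset M /\ B \subset M by apply/andP; rewrite -subUset.
  by apply: rpredB; apply: tensX;
     rewrite ?cardsU1 ?nAa ?nAb ?nBa ?nBb ?cardA ?cardB //
       ?subUset ?sub1set ?Ma ?Mb ?sAM ?sBM //
       disjoint_setU1s // eq_sym.
suff -> : X = fullv by exact: memvf.
apply/eqP; rewrite eqEdim subvf dimvf dim_matrix /=.
suff : (k.+1 ^ 2 + #|M| <= \dim X)%N by rewrite cardM; nia.
apply: (dim_diff_ideal (w := fun i => t (enum_val i))) idealX _ => i.
have cardMi : #|M :\ enum_val i| = (2 * k.+1)%N.
  by have := cardsD1 (enum_val i) M; rewrite enum_valP cardM; lia.
have [|A sAMi cardA] := @ex_subset_card _ (M :\ enum_val i) k.+1.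
  by rewrite cardMi; lia.
pose B := (M :\ enum_val i) :\: A.
have cardB : #|B| = k.+1.
  by rewrite cardsD (setIidPr sAMi) cardMi cardA; lia.
exists (tensor k.+2 (node_poly A) (node_poly B)).
  apply: tensX => //; last by rewrite disjoints_subset /B setCD subsetUr.
  rewrite subUset /B (subset_trans sAMi) ?subsetDl //=.
  by rewrite (subset_trans (subsetDl _ _)) ?subsetDl.
move=> j; rewrite diag_eval_tensor ?size_node_poly ?cardA ?cardB //.
rewrite mulf_eq0 -!rootE !root_node_poly -in_setU.
have -> : A :|: B = M :\ enum_val i.
  apply/setP=> x; rewrite /B 2!inE.
  by case: (boolP (x \in A)) => //= /(subsetP sAMi) ->.
by rewrite !inE enum_valP andbT negbK (inj_eq enum_val_inj).
Qed.

(** The weights at one vertex form a pencil of linear factors, so [X] also contains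
    the products without these factors; two of them that differ by moving [x] from
    one factor to the other differ by [(y - z) P_A(y) P_B(z)].  All multiples of
    [y - z] follow by [disjoint_tensors_span], and the diagonal adds two dimensions,
    seen at two points [w] that are not nodes. *)
Lemma tensors_rank k (X : {vspace 'M[F]_k.+2}) (w : 'I_2 -> F) :
    (0 < k)%N -> #|I| = (2 * k).+1 -> injective w -> (forall i x, w i != t x) ->
    (forall S x, #|S| = k -> x \notin S ->
       tensor k.+2 (node_poly (x |: S)) (node_poly (~: S)) \in X) ->
  (k.+1 ^ 2 + 2 <= \dim X)%N.
Proof.
move=> k_gt0 cardI inj_w wNt tensX.
have cardC S : (#|S| + #|~: S|)%N = (2 * k).+1 by rewrite cardsC.
have pencilT T : #|T| = k.+1 -> tensor k.+2 (node_poly T) (node_poly (~: T)) \in X /\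
    forall c, tensor k.+2 (node_poly T) (('X - c%:P) * node_poly (~: T)) \in X.
  move=> cardT; have /card_gt1P[x [y [Tx Ty neq_xy]]] : (1 < #|T|)%N.
    by rewrite cardT.
  have XT z : z \in T ->
      tensor k.+2 (node_poly T) (('X - (t z)%:P) * node_poly (~: T)) \in X.
    move=> Tz; have := tensX (T :\ z) z; rewrite setD1K // setCD setUC.
    rewrite node_polyU1 ?inE ?Tz // eqxx; apply=> //.
    by have := cardsD1 z T; rewrite Tz cardT => -[].
  by apply: pencil_r (XT x Tx) (XT y Ty); rewrite (inj_eq inj_t).
have pencilS S : #|S| = k -> tensor k.+2 (node_poly S) (node_poly (~: S)) \in X.
  move=> cardS; have /card_gt1P[x [y [Sx Sy neq_xy]]] : (1 < #|~: S|)%N.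
    by have := cardC S; lia.
  have XS z : z \in ~: S ->
      tensor k.+2 (('X - (t z)%:P) * node_poly S) (node_poly (~: S)) \in X.
    by rewrite inE => Sz; rewrite -node_polyU1 // tensX.
  by case: (@pencil_l _ X _ _ _ _ _ (XS x Sx) (XS y Sy)); rewrite ?(inj_eq inj_t).
(* Moving x, the element outside A and B, from one factor to the other. *)
have idealX D : mul_diff D \in X.
  have := @disjoint_tensors_span k setT (linfun (@mul_diff k.+1) @^-1: X)%VS _ _ D.
  rewrite -memv_preim lfunE cardsT; apply=> // A B _ dAB cardA cardB.
  rewrite -memv_preim lfunE /=.
  have cardAB : #|~: (A :|: B)| = 1%N.
    have := cardC (A :|: B); rewrite cardsU disjoint_setI0 // cards0 cardA cardB.
    lia.
  have /cards1P[x defx] : #|~: (A :|: B)| == 1%N by rewrite cardAB.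
  have : x \in ~: (A :|: B) by rewrite defx set11.
  rewrite !inE negb_or => /andP[nAx nBx].
  have xCA : ~: (x |: A) = B.
    apply/setP=> z; have /setP/(_ z) := defx; rewrite !inE !negb_or => <-.
    by case: (boolP (z \in A)) => [/(disjointFr dAB)-> //|_] /=;
       rewrite !andbT negbK.
  have xCB : ~: A = x |: B.
    rewrite -xCA setCU setUIr setUCr setTI; apply/esym/setUidPr.
    by rewrite sub1set inE.
  rewrite -(@tensor_swap_factor _ (t x)) ?size_node_poly ?cardA ?cardB //.
  rewrite -!node_polyU1 // rpredB //.
    by have [] := pencilT (x |: A); rewrite ?cardsU1 ?nAx ?cardA // xCA.
  by rewrite -xCB pencilS.
have [S cardS] : exists S : {set I}, #|S| = k.+1.
  have [|S _] := @ex_subset_card _ [set: I] k.+1; last by exists S.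
  by rewrite cardsT cardI; lia.
apply: (dim_diff_ideal (w := w)) idealX _ => i.
(* The linear factor kills the other of the two points. *)
exists (tensor k.+2 (node_poly S) (('X - (w (rev_ord i))%:P) * node_poly (~: S))).
  by case: (pencilT S cardS).
have cardSC : #|~: S| = k by have := cardC S; lia.
have wN0 j A : (node_poly A).[w j] != 0.
  by rewrite horner_prod; apply/prodf_neq0=> x _; rewrite hornerXsubC subr_eq0.
move=> j; rewrite diag_eval_tensor ?size_node_poly ?cardS //; last first.
  by rewrite (leq_trans (size_polyMleq _ _)) // size_XsubC size_node_poly cardSC.
rewrite hornerM hornerXsubC !mulf_eq0 !(negbTE (wN0 _ _)) orbF /= subr_eq0.
rewrite (inj_eq inj_w) -!val_eqE /=.
by case: i j => [[|[|//]] ?] [[|[|//]] ?].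
Qed.

End Nodes.

End BivariatePolynomials.
(** * Seeds for an interval of the Boolean lattice *)

Section Interval.

Variables (T : finType) (k : nat).
Implicit Types (L R S U V : {set T}) (Q : {set T} -> Prop) (x y z : T).

(** Families of sets are studied on the levels [k] and [k + 1] only, called lower and
    upper below; the level [k] is the same for all intervals. *)
Definition middle S := (#|S| == k) || (#|S| == k.+1).

Definition all_middle L R Q :=
  forall S, middle S -> L \subset S -> S \subset R -> Q S.

(** In [goes_up] and [goes_down] one active neighbour inside the interval is enough;
    [two_down] and [two_up] are the steps of the percolation process with threshold
    two, towards a lower and towards an upper set. *)
Definition goes_up L R Q := forall S x, #|S| = k -> x \notin S ->
  L \subset S -> x |: S \subset R -> Q S -> Q (x |: S).

Definition goes_down L R Q := forall S x, #|S| = k -> x \notin S ->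
  L \subset S -> x |: S \subset R -> Q (x |: S) -> Q S.

Definition two_down L R Q := forall S x y, #|S| = k -> x \notin S -> y \notin S ->
  x != y -> L \subset S -> x |: S \subset R -> y |: S \subset R ->
  Q (x |: S) -> Q (y |: S) -> Q S.

Definition two_up L R Q := forall S x y, #|S| = k.+1 -> x \in S -> y \in S ->
  x != y -> L \subset S :\ x -> L \subset S :\ y -> S \subset R ->
  Q (S :\ x) -> Q (S :\ y) -> Q S.

(** Inside the interval, going down from an active upper set and up again exchanges
    one of its elements for any other, and exchanges connect the level. *)
Lemma middle_connected L R Q U :
    goes_up L R Q -> goes_down L R Q ->
    k < #|R| -> middle U -> L \subset U -> U \subset R -> Q U ->
  all_middle L R Q.
Proof.
move=> up down ltkR midU sLU sUR QU.
wlog cardU : U {midU} sLU sUR QU / #|U| = k.+1 => [wlogU|].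
  have /orP[/eqP cardU | /eqP cardU] := midU; last exact: wlogU cardU.
  have /subsetPn[x Rx nUx] : ~~ (R \subset U).
    by apply/negP=> /subset_leq_card; rewrite cardU leqNgt ltkR.
  have sxUR : x |: U \subset R by rewrite subUset sub1set Rx.
  apply: wlogU (sxUR) _ (cardsU1_eq cardU nUx).
    exact: subset_trans sLU (subsetUr _ _).
  by apply: up.
have upper n V : #|V :\: U| < n -> #|V| = k.+1 -> L \subset V -> V \subset R -> Q V.
  elim: n V => // n IHn V ltVn cardV sLV sVR.
  have [/eqP VU0 | [d]] := set_0Vmem (V :\: U).
    rewrite setD_eq0 in VU0.
    suff /eqP-> : V == U by [].
    by rewrite eqEcard VU0 cardU cardV leqnn.
  rewrite inE => /andP[nUd Vd].
  have /subsetPn[c Uc nVc] : ~~ (U \subset V).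
    apply/negP=> sUV; have : U == V by rewrite eqEcard sUV cardU cardV leqnn.
    by move/eqP=> defU; rewrite defU Vd in nUd.
  have cardS := cardsD1_eq cardV Vd.
  have sLS : L \subset V :\ d.
    by rewrite subsetD1 sLV; apply: contra nUd => /(subsetP sLU).
  have nSc : c \notin V :\ d by rewrite inE (negbTE nVc) andbF.
  have sSR : V :\ d \subset R by apply: subset_trans (subsetDl _ _) sVR.
  have scSR : c |: V :\ d \subset R by rewrite subUset sub1set (subsetP sUR).
  rewrite -(setD1K Vd); apply: up; rewrite ?setD1K ?inE ?eqxx //.
  apply: (down _ c) => //; apply: IHn => //.
  - rewrite -ltnS (leq_trans _ ltVn) // ltnS proper_card //.
    apply/properP; split; last first.
      exists d; first by rewrite inE nUd.
      by rewrite !inE nUd eqxx orbF; apply: contraNneq nVc => <-.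
    apply/subsetP=> i; rewrite !inE => /andP[nUi /predU1P[ic | /andP[_ ->]]].
      by rewrite ic Uc in nUi.
    by rewrite nUi.
  - exact: cardsU1_eq.
  by rewrite (subset_trans sLS) ?subsetUr.
move=> S /orP[]/eqP cardS sLS sSR; last exact: upper (ltnSn _) _ _ _.
have /subsetPn[x Rx nSx] : ~~ (R \subset S).
  by apply/negP=> /subset_leq_card; rewrite cardS leqNgt ltkR.
have sxSR : x |: S \subset R by rewrite subUset sub1set Rx.
apply: (down S x) => //; apply: upper (ltnSn _) _ _ _ => //.
  exact: cardsU1_eq.
by rewrite (subset_trans sLS) ?subsetUr.
Qed.

(** A lower set [S] without [z] has the active neighbour [z |: S], so among the sets
    without [z] activity spreads through single edges, from [U]. *)
Lemma middle_extend L R Q z U :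
    goes_up L R Q -> two_down L R Q -> z \in R -> z \notin L ->
    all_middle (z |: L) R Q ->
    #|U| = k.+1 -> L \subset U -> U \subset R :\ z -> Q U ->
  all_middle L R Q.
Proof.
move=> up two Rz nLz Qz cardU sLU sUR QU S midS sLS sSR.
have [Sz | nSz] := boolP (z \in S).
  by apply: Qz; rewrite // subUset sub1set Sz.
have sR' := subsetDl R [set z].
have SR' : S \subset R :\ z by rewrite subsetD1 sSR.
apply: (@middle_connected L (R :\ z) Q U) midS sLS SR' => //.
- move=> V x cardV nVx sLV sxVR; apply: up => //; exact: subset_trans sR'.
- move=> V x cardV nVx sLV sxVR QxV.
  have := subsetP sxVR x; rewrite !inE eqxx => /(_ isT)/andP[neq_xz Rx].
  have nVz : z \notin V.
    apply/negP=> Vz; have := subsetP sxVR z.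
    by rewrite !inE Vz orbT eqxx => /(_ isT).
  have sVR : V \subset R.
    by apply: subset_trans sR'; apply: subset_trans sxVR; apply: subsetUr.
  have szV : z |: V \subset R by rewrite subUset sub1set Rz.
  apply: (two V x z) => //; first by rewrite subUset sub1set Rx.
  apply: Qz => //; first by rewrite /middle (cardsU1_eq cardV nVz) eqxx orbT.
  exact: setUS.
- by rewrite -cardU subset_leq_card.
by rewrite /middle cardU eqxx orbT.
Qed.

(** When upper sets need one active neighbour, a seed of size [k] lowers the size of
    the bottom set by two: choose [z] and [z'] in [L0] but not in [L], and a lower
    set [C] avoiding both.  Its supersets [z' |: C] and [z |: C] serve as the set [U]
    of [middle_extend], first to drop [z] and then to drop [z'].

    The useful [L0] are an upper set and a set of [k + 2] elements, since [[L0, R]]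
    then has at most one middle set. *)
Lemma lower_seeds h L L0 R :
    L \subset L0 -> L0 \subset R -> #|L0| = #|L| + 2 * h ->
    #|L0| <= k.+2 <= #|R| ->
  exists A : seq {set T}, [/\ size A = h, forall S, S \in A -> #|S| = k &
    forall Q, goes_up L R Q -> two_down L R Q -> (forall S, S \in A -> Q S) ->
      all_middle L0 R Q -> all_middle L R Q].
Proof.
elim: h L => [|h IHh] L sL0 sL0R cardL0 boundR.
  exists nil; split=> // Q _ _ _; suff -> : L = L0 by [].
  by apply/eqP; rewrite eqEcard sL0 cardL0 addn0 leqnn.
have /card_gt1P[z [z' [zL z'L neq_z]]] : 1 < #|L0 :\: L|.
  by rewrite cardsD (setIidPr sL0) cardL0; card_lia.
move: zL z'L; rewrite !inE => /andP[nLz L0z] /andP[nLz' L0z'].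
have Rz := subsetP sL0R _ L0z; have Rz' := subsetP sL0R _ L0z'.
have nz'L : z \notin z' |: L by rewrite !inE negb_or neq_z.
have cardzzL : #|z |: (z' |: L)| = #|L|.+2.
  by rewrite !cardsU1 nz'L nLz'.
have [||A [sizeA midA spanA]] := IHh (z |: (z' |: L)) _ sL0R _ boundR.
- by rewrite !subUset !sub1set L0z L0z'.
- by rewrite cardzzL; card_lia.
have cardR' : #|R :\ z :\ z'| = #|R| - 2.
  have := cardsD1 z R; have := cardsD1 z' (R :\ z).
  by rewrite Rz !inE eq_sym neq_z Rz' /=; card_lia.
have sLR' : L \subset R :\ z :\ z'.
  by rewrite !subsetD1 (subset_trans sL0 sL0R) nLz nLz'.
have [|C [sLC sCR cardC]] := @ex_set_between _ _ _ k sLR'.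
  by rewrite cardR'; card_lia.
move: sCR; rewrite !subsetD1 => /andP[/andP[sCR nCz] nCz'].
exists (C :: A); split=> [|S|Q up two QCA QL0]; first by rewrite /= sizeA.
  by rewrite inE => /predU1P[->|/midA].
have sLz' : L \subset z' |: L by apply: subsetUr.
have sz'LC : z' |: L \subset z' |: C by apply: setUS.
have sz'CR : z' |: C \subset R by rewrite subUset sub1set Rz'.
have QC : Q C by apply: QCA; rewrite inE eqxx.
apply: (@middle_extend L R Q z' (z |: C)) => //.
- apply: (@middle_extend (z' |: L) R Q z (z' |: C)) => //.
  + by move=> S x cardS nSx sLS; apply: up; rewrite // (subset_trans sLz').
  + by move=> S x y ? ? ? ? sLS; apply: two; rewrite // (subset_trans sLz').
  + apply: spanA => //.
    * move=> S x cardS nSx sLS; apply: up; rewrite // (subset_trans _ sLS) //.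
      by rewrite (subset_trans sLz') ?subsetUr.
    * move=> S x y ? ? ? ? sLS; apply: two; rewrite // (subset_trans _ sLS) //.
      by rewrite (subset_trans sLz') ?subsetUr.
    by move=> S AS; apply: QCA; rewrite inE AS orbT.
  + exact: cardsU1_eq.
  + by rewrite subsetD1 sz'CR !inE negb_or neq_z.
  exact: up.
- exact: cardsU1_eq.
- by rewrite (subset_trans sLC) ?subsetUr.
- by rewrite subsetD1 subUset sub1set Rz sCR !inE negb_or eq_sym neq_z.
by apply: up => //; rewrite subUset sub1set Rz.
Qed.

(** The image of [lower_seeds] under complementation, which exchanges the two levels
    of a ground set of [2 k + 1] elements. *)
Lemma upper_seeds h L R0 R : #|T| = (2 * k).+1 ->
    L \subset R0 -> R0 \subset R -> #|R| = #|R0| + 2 * h ->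
    #|L| < k <= #|R0|.+1 ->
  exists A : seq {set T}, [/\ size A = h, forall S, S \in A -> #|S| = k.+1 &
    forall Q, goes_down L R Q -> two_up L R Q -> (forall S, S \in A -> Q S) ->
      all_middle L R0 Q -> all_middle L R Q].
Proof.
move=> cardT sLR0 sR0R cardR boundL.
have cardC S := cardsC S; rewrite cardT in cardC.
have [||||A [sizeA midA spanA]] := @lower_seeds h (~: R) (~: R0) (~: L).
- by rewrite setCS.
- by rewrite setCS.
- by have := cardC R; have := cardC R0; card_lia.
- by have := cardC L; have := cardC R0; card_lia.
exists [seq ~: U | U <- A]; split; first by rewrite size_map.
  move=> _ /mapP[S /midA cardS ->]; have := cardC S; card_lia.
move=> Q down two QA QR0 S midS sLS sSR.
have CU1 x U : ~: (x |: U) = (~: U) :\ x by rewrite setCU setIC -setDE.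
have subC U V : (U \subset ~: V) = (V \subset ~: U) by rewrite -setCS setCK.
rewrite -(setCK S); apply: (spanA (fun U => Q (~: U))).
- move=> U x cardU nUx sRU sxUL; rewrite CU1 => QU.
  have Ux : x \in ~: U by rewrite inE.
  apply: (down _ x); rewrite ?setD1K ?inE ?eqxx -?CU1 //.
  + by have := cardC (x |: U); rewrite (cardsU1_eq cardU nUx); card_lia.
  + by rewrite subC.
  + by rewrite -setCS setCK.
- move=> U x y cardU nUx nUy neq_xy sRU sxUL syUL; rewrite !CU1.
  apply: two; rewrite ?inE -?CU1 1?subC //.
  + by have := cardC U; rewrite cardU; card_lia.
  + by rewrite -setCS setCK.
- by move=> U AU; apply: QA; apply: map_f.
- move=> U midU sR0U sUL; apply: QR0; last by rewrite -setCS setCK.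
    move: midU; rewrite /middle; have := cardC U => cU.
    by case/orP=> /eqP cardU; apply/orP; [right | left]; apply/eqP; card_lia.
  by rewrite subC.
- move: midS; rewrite /middle; have := cardC S => cS.
  by case/orP=> /eqP cardS; apply/orP; [right | left]; apply/eqP; card_lia.
- by rewrite setCS.
by rewrite setCS.
Qed.

Definition closed_family Q :=
  two_down set0 setT Q /\ two_up set0 setT Q.

Lemma closed_familyS L R Q : closed_family Q ->
  two_down L R Q /\ two_up L R Q.
Proof.
case=> down up; split.
  by move=> S x y ? ? ? ? _ _ _; apply: down; rewrite ?sub0set ?subsetT.
by move=> S x y ? ? ? ? _ _ _; apply: up; rewrite ?sub0set ?subsetT.
Qed.

(** The four quadrants of [[L, R]] are given by which of [a] and [b] a set
    contains.  The quadrant with [a] and without [b] is active. *)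
Section Quadrants.

Variables (L R : {set T}) (Q : {set T} -> Prop) (a b : T).
Hypotheses (percQ : closed_family Q) (Ra : a \in R) (nLb : b \notin L).
Hypotheses (neq_ab : a != b) (Q10 : all_middle (a |: L) (R :\ b) Q).

(** An upper set with [a] and [b] has the active neighbour obtained by removing
    [b]. *)
Lemma quadrant_goes_up : goes_up (a |: (b |: L)) R Q.
Proof.
move=> S x cardS nSx; rewrite !subUset !sub1set => /and3P[Sa Sb sLS] sxSR QS.
have [_ two] := percQ.
have cardxS := cardsU1_eq cardS nSx.
have neq_bx : b != x by apply: contraNneq nSx => <-.
apply: (two _ x b); rewrite ?sub0set ?subsetT ?setU1K ?inE ?eqxx ?Sb ?orbT //.
  by rewrite eq_sym.
apply: Q10.
- by rewrite /middle (cardsD1_eq cardxS) ?eqxx // !inE Sb orbT.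
- rewrite subsetD1 subUset sub1set !inE Sa orbT negb_or eq_sym neq_ab nLb !andbT.
  by rewrite (subset_trans sLS) ?subsetUr.
by rewrite setSD // subUset sub1set.
Qed.

(** A lower set with neither [a] nor [b] has the active neighbour obtained by adding
    [a]. *)
Lemma quadrant_goes_down : goes_down L (R :\ a :\ b) Q.
Proof.
move=> S x cardS nSx sLS; rewrite !subsetD1 => /andP[/andP[sxSR nxSa] nxSb] QxS.
have [two _] := percQ.
have [neq_ax nSa] : a != x /\ a \notin S.
  by apply/andP; move: nxSa; rewrite !inE negb_or.
have [neq_bx nSb] : b != x /\ b \notin S.
  by apply/andP; move: nxSb; rewrite !inE negb_or.
apply: (two _ x a); rewrite ?sub0set ?subsetT // 1?eq_sym //.
apply: Q10; first by rewrite /middle (cardsU1_eq cardS nSa) eqxx orbT.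
  exact: setUS.
rewrite subsetD1 subUset sub1set Ra !inE negb_or eq_sym neq_ab nSb !andbT.
by rewrite (subset_trans _ sxSR) ?subsetUr.
Qed.

(** In the remaining quadrant, with [b] and without [a], lower sets have the active
    neighbour obtained by adding [a] and upper sets the one obtained by removing [b].
    So one active set [U] is enough, by connectedness. *)
Lemma four_quadrants U :
    k.+1 < #|R| ->
    all_middle (a |: (b |: L)) R Q -> all_middle L (R :\ a :\ b) Q ->
    middle U -> b |: L \subset U -> U \subset R :\ a -> Q U ->
  all_middle L R Q.
Proof.
move=> ltkR Q11 Q00 midU sbLU sURa QU.
have Q01 : all_middle (b |: L) (R :\ a) Q.
  apply: middle_connected midU sbLU sURa QU.
  - move=> S x cardS nSx; rewrite subUset sub1set subsetD1.
    move=> /andP[Sb sLS] /andP[sxSR nxSa] QS.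
    have [_ two] := percQ.
    have cardxS := cardsU1_eq cardS nSx.
    have neq_bx : b != x by apply: contraNneq nSx => <-.
    apply: (two _ x b); rewrite ?sub0set ?subsetT ?setU1K ?inE ?eqxx ?Sb ?orbT //.
      by rewrite eq_sym.
    apply: Q00.
    + by rewrite /middle (cardsD1_eq cardxS) ?eqxx // !inE Sb orbT.
    + by rewrite subsetD1 nLb andbT (subset_trans sLS) ?subsetUr.
    by apply: setSD; rewrite subsetD1 sxSR.
  - move=> S x cardS nSx; rewrite subUset sub1set subsetD1.
    move=> /andP[Sb sLS] /andP[sxSR nxSa] QxS.
    have [two _] := percQ.
    have [neq_ax nSa] : a != x /\ a \notin S.
      by apply/andP; move: nxSa; rewrite !inE negb_or.
    apply: (two _ x a); rewrite ?sub0set ?subsetT // 1?eq_sym //.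
    apply: Q11; first by rewrite /middle (cardsU1_eq cardS nSa) eqxx orbT.
      by rewrite setUS // subUset sub1set Sb.
    by rewrite subUset sub1set Ra (subset_trans _ sxSR) ?subsetUr.
  by have := cardsD1 a R; rewrite Ra; card_lia.
move=> S midS sLS sSR.
case: (boolP (a \in S)) (boolP (b \in S)) => [Sa|nSa] [Sb|nSb].
- by apply: Q11; rewrite // !subUset !sub1set Sa Sb.
- by apply: Q10; rewrite // ?subUset ?sub1set ?Sa // subsetD1 sSR.
- by apply: Q01; rewrite // ?subUset ?sub1set ?Sb // subsetD1 sSR.
by apply: Q00; rewrite // !subsetD1 sSR nSa.
Qed.

End Quadrants.

(** The edge count [2 * size A + ~~ odd j] counts two active edges for each seed, and
    one more for the half vertex [v] when [j] is even: [v] is activated by its single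
    neighbour [x |: v].

    In the step to an odd [j], the seed [w = b |: v0] activates the half vertex [v0]
    of the smaller interval and is also the upper set that starts [lower_seeds];
    the seed [u = b |: R0] activates the lower set [R0] that starts [upper_seeds] and
    starts the last quadrant.  In the step to an even [j], the parity is right for
    starting [lower_seeds] and [upper_seeds] from intervals without middle sets, and
    the new half vertex starts the last quadrant. *)
Lemma percolating_seeds j L R : #|T| = (2 * k).+1 ->
    L \subset R -> #|L| + j = k -> #|R| = k + j.+1 ->
  exists (A : seq {set T}) (v : {set T}) x, [/\ [/\ forall S, S \in A -> middle S,
     #|v| = k, x \notin v, L \subset v & x |: v \subset R],
     2 * size A + ~~ odd j = j.+1 ^ 2 + 2 &
     forall Q, closed_family Q -> (forall S, S \in A -> Q S) ->
       odd j \/ (Q (x |: v) -> Q v) -> all_middle L R Q].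
Proof.
move=> cardT; elim: j L R => [|j IHj] L R sLR cardL cardR.
  have [RL0|[x xRL]] := set_0Vmem (R :\: L).
    move/eqP: RL0; rewrite setD_eq0 => /subset_leq_card; rewrite cardR; card_lia.
  move: (xRL); rewrite inE => /andP[nLx Rx].
  have sxLR : x |: L \subset R by rewrite subUset sub1set Rx.
  have cardxL : #|x |: L| = k.+1 by apply: cardsU1_eq; rewrite // -cardL addn0.
  have defR : R = x |: L.
    by apply/esym/eqP; rewrite eqEcard sxLR cardxL cardR addn1 leqnn.
  exists [:: R], L, x; split=> [|//|Q _ QR [//|QL] S midS sLS sSR].
    split=> //; last by rewrite -cardL addn0.
    by move=> S; rewrite inE => /eqP->; rewrite /middle defR cardxL eqxx orbT.
  have QRR : Q R by apply: QR; rewrite inE.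
  case/orP: midS => /eqP cardS.
    suff /eqP <- : L == S by apply: QL; rewrite -defR.
    by rewrite eqEcard sLS cardS -cardL addn0 leqnn.
  suff /eqP -> : S == R by [].
  by rewrite eqEcard sSR cardS cardR addn1 leqnn.
have /card_gt1P[a [b [aRL bRL neq_ab]]] : 1 < #|R :\: L|.
  by rewrite cardsD (setIidPr sLR); card_lia.
move: aRL bRL; rewrite !inE => /andP[nLa Ra] /andP[nLb Rb].
have nbLa : a \notin b |: L by rewrite !inE negb_or neq_ab.
have cardbL : #|b |: L| = #|L|.+1 by apply: cardsU1_eq.
have cardabL : #|a |: (b |: L)| = #|L|.+2 by apply: cardsU1_eq.
have cardaL : #|a |: L| = #|L|.+1 by apply: cardsU1_eq.
have cardRa : #|R :\ a| = k + j.+1.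
  by have := cardsD1 a R; rewrite Ra cardR addnS => -[].
have cardRb : #|R :\ b| = k + j.+1.
  by have := cardsD1 b R; rewrite Rb cardR addnS => -[].
have cardRab : #|R :\ a :\ b| = k + j.
  by have := cardsD1 b (R :\ a); rewrite !inE eq_sym neq_ab Rb cardRa addnS => -[].
have saLRb : a |: L \subset R :\ b.
  by rewrite subsetD1 subUset sub1set Ra sLR !inE negb_or eq_sym neq_ab.
have sbLRa : b |: L \subset R :\ a by rewrite subsetD1 subUset sub1set Rb sLR.
have sabLR : a |: (b |: L) \subset R by rewrite !subUset !sub1set Ra Rb.
have sLRab : L \subset R :\ a :\ b by rewrite !subsetD1 sLR nLa nLb.
have [||A0 [v0 [x0 [[midA0 cardv0 nvx0 saLv0 sxvR] sizeA0 spanA0]]]] :=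
  IHj _ _ saLRb.
- by rewrite cardaL; card_lia.
- exact: cardRb.
have [odd_j | even_j] := boolP (odd j).
  (* L0 lies above the middle levels and R0 below them. *)
  have [|L0 [sL0 sL0R cardL0]] := @ex_set_between _ _ _ k.+2 sabLR.
    by rewrite cardabL cardR; card_lia.
  have [|R0 [sLR0 sR0R cardR0]] := @ex_set_between _ _ _ k.-1 sLRab.
    by rewrite cardRab; card_lia.
  have [|v [sbLv svR cardv]] := @ex_set_between _ _ _ k sbLRa.
    by rewrite cardbL cardRa; card_lia.
  have [||A1 [sizeA1 midA1 spanA1]] := @lower_seeds j.+1./2 _ _ _ sL0 sL0R.
  - by rewrite cardabL cardL0; card_lia.
  - by rewrite cardL0 cardR; card_lia.
  have [||A2 [sizeA2 midA2 spanA2]] := @upper_seeds j.+1./2 _ _ _ cardT sLR0 sR0R.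
  - by rewrite cardRab cardR0; card_lia.
  - by rewrite cardR0; card_lia.
  have := svR; rewrite subsetD1 => /andP[svR' nva].
  exists (A0 ++ A1 ++ A2), v, a; split.
  - split=> //; last by rewrite subUset sub1set Ra.
      move=> S; rewrite !mem_cat => /or3P[/midA0 // | /midA1 | /midA2] cardS;
        by rewrite /middle cardS eqxx ?orbT.
    by rewrite (subset_trans _ sbLv) ?subsetUr.
  - by move: sizeA0; rewrite !size_cat sizeA1 sizeA2 /= odd_j; card_lia.
  move=> Q percQ QA [|halfv]; first by rewrite /= odd_j.
  have Q10 : all_middle (a |: L) (R :\ b) Q.
    by apply: spanA0 => // [S AS|]; [apply: QA; rewrite mem_cat AS | left].
  have Q11 : all_middle (a |: (b |: L)) R Q.
    apply: spanA1.
    - exact: quadrant_goes_up.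
    - by have [] := closed_familyS (a |: (b |: L)) R percQ.
    - by move=> S AS; apply: QA; rewrite !mem_cat AS orbT.
    move=> S midS sL0S _; have := subset_leq_card sL0S; rewrite cardL0.
    by case/orP: midS => /eqP->; rewrite ltnNge ?leqnSn ?leqnn // -ltnS leqnSn.
  have Q00 : all_middle L (R :\ a :\ b) Q.
    apply: spanA2.
    - exact: quadrant_goes_down.
    - by have [] := closed_familyS L (R :\ a :\ b) percQ.
    - by move=> S AS; apply: QA; rewrite !mem_cat AS !orbT.
    move=> S midS _ sSR0; have := subset_leq_card sSR0; rewrite cardR0.
    by case/orP: midS => /eqP->; card_lia.
  have midv : middle v by rewrite /middle cardv eqxx.
  apply: (@four_quadrants L R Q a b) midv (sbLv) svR _ => //.
    by rewrite cardR; card_lia.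
  apply: halfv; apply: Q11.
  - by rewrite /middle (cardsU1_eq cardv nva) eqxx orbT.
  - by rewrite setUS.
  by rewrite subUset sub1set Ra.
move: saLv0 sxvR; rewrite subsetD1 !subUset !sub1set !inE negb_or.
case/andP=> v0a sLv0 /andP[/andP[Rx0 sv0R] /andP[neq_bx0 nv0b]].
pose w := b |: v0; have cardw : #|w| = k.+1 by apply: cardsU1_eq.
have sw : a |: (b |: L) \subset w by rewrite subUset sub1set !inE v0a orbT setUS.
have swR : w \subset R by rewrite subUset sub1set Rb.
have [|R0 [sLR0 sR0R cardR0]] := @ex_set_between _ _ _ k sLRab.
  by rewrite cardRab; card_lia.
have [||A1 [sizeA1 midA1 spanA1]] := @lower_seeds j./2 _ _ _ sw swR.
- by rewrite cardabL cardw; card_lia.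
- by rewrite cardw cardR; card_lia.
have [||A2 [sizeA2 midA2 spanA2]] := @upper_seeds j./2 _ _ _ cardT sLR0 sR0R.
- by rewrite cardRab cardR0; card_lia.
- by rewrite cardR0; card_lia.
have := sR0R; rewrite !subsetD1 => /andP[/andP[sR0R' nR0a] nR0b].
pose u := b |: R0; have cardu : #|u| = k.+1 by apply: cardsU1_eq.
exists (w :: u :: A0 ++ A1 ++ A2), v0, x0; split.
- split=> //; last by rewrite subUset sub1set Rx0.
  move=> S; rewrite !inE !mem_cat.
  case/or3P=> [/eqP-> | /eqP-> | /or3P[/midA0 // | /midA1 | /midA2] cardS];
    by rewrite /middle ?cardw ?cardu ?cardS eqxx ?orbT.
- by move: sizeA0; rewrite /= !size_cat sizeA1 sizeA2 even_j; card_lia.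
move=> Q percQ QA _.
have Q10 : all_middle (a |: L) (R :\ b) Q.
  apply: spanA0 => // [S AS|]; first by apply: QA; rewrite !inE mem_cat AS !orbT.
  right=> Qxv0; have [two _] := percQ.
  apply: (two _ x0 b); rewrite ?sub0set ?subsetT // 1?eq_sym //.
  by apply: QA; rewrite inE eqxx.
have Q11 : all_middle (a |: (b |: L)) R Q.
  apply: spanA1.
  - exact: quadrant_goes_up.
  - by have [] := closed_familyS (a |: (b |: L)) R percQ.
  - by move=> S AS; apply: QA; rewrite !inE !mem_cat AS !orbT.
  move=> S midS swS _; suff /eqP <- : w == S by apply: QA; rewrite inE eqxx.
  by rewrite eqEcard swS cardw; case/orP: midS => /eqP->; rewrite ?leqnn ?leqnSn.
have Q00 : all_middle L (R :\ a :\ b) Q.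
  apply: spanA2.
  - exact: quadrant_goes_down.
  - by have [] := closed_familyS L (R :\ a :\ b) percQ.
  - by move=> S AS; apply: QA; rewrite !inE !mem_cat AS !orbT.
  move=> S midS _ sSR0; have /eqP-> : S == R0.
    by rewrite eqEcard sSR0 cardR0; case/orP: midS => /eqP->; rewrite ?leqnn ?leqnSn.
  have [two _] := percQ.
  apply: (two _ a b); rewrite ?sub0set ?subsetT //.
    apply: Q10; first by rewrite /middle (cardsU1_eq cardR0 nR0a) eqxx orbT.
      exact: setUS.
    by rewrite subsetD1 subUset sub1set Ra sR0R' !inE negb_or eq_sym neq_ab.
  by apply: QA; rewrite !inE eqxx orbT.
have midu : middle u by rewrite /middle cardu eqxx orbT.
apply: (four_quadrants percQ Ra nLb Q10 _ Q11 Q00 midu).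
- by rewrite cardR; card_lia.
- exact: setUS.
- by rewrite subsetD1 subUset sub1set Rb sR0R' !inE negb_or neq_ab.
by apply: QA; rewrite !inE eqxx orbT.
Qed.

End Interval.
(** * The bipartite odd graph *)

Section BipartiteOddGraph.

Variable k : nat.
Hypothesis k_gt0 : 0 < k.

Notation G := (bipartite_odd_graph k).
Notation ground := 'I_(2 * k + 1).
Implicit Types (S : {set ground}) (u v w : G) (x y : ground).

Lemma card_ground : #|{: ground}| = (2 * k).+1.
Proof. by rewrite card_ord addn1. Qed.

Lemma vertex_middle v : middle k (val v).
Proof. exact: valP. Qed.

Lemma ex_vertex S : middle k S -> exists v : G, val v = S.
Proof. by move=> midS; exists (Sub S midS : bog_vertex k); rewrite SubK. Qed.

Lemma proper_setU1 v w x :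
  x \notin val v -> val w = x |: val v -> val v \proper val w.
Proof.
move=> nvx ->; apply/properP.
by split; [apply: subsetUr | exists x; rewrite // setU11].
Qed.

Lemma adj_setU1 v w x : x \notin val v -> val w = x |: val v -> adj v w.
Proof. by move=> nvx /(proper_setU1 nvx) vw; apply/orP; left. Qed.

Lemma adj_setD1 v w x : x \in val v -> val w = val v :\ x -> adj v w.
Proof.
move=> vx def_w; rewrite adj_sym; apply: (@adj_setU1 _ _ x).
  by rewrite def_w setD11.
by rewrite def_w setD1K.
Qed.

Lemma properU1 v w : val v \proper val w ->
  [/\ #|val v| = k, #|val w| = k.+1 &
      exists2 x, x \notin val v & val w = x |: val v].
Proof.
move=> vw; have /properP[svw [x wx nvx]] := vw.
have [cardv cardw] : #|val v| = k /\ #|val w| = k.+1.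
  have := proper_card vw.
  by case/orP: (vertex_middle v) (vertex_middle w) => /eqP-> /orP[]/eqP->; card_lia.
split=> //; exists x => //; apply/esym/eqP.
by rewrite eqEcard subUset sub1set wx svw (cardsU1_eq cardv nvx) cardw leqnn.
Qed.

Lemma adj_lower v w : #|val v| = k -> adj v w ->
  exists2 x, x \notin val v & val w = x |: val v.
Proof.
move=> cardv /orP[/properU1[] // | /properU1[_ cardv' _]].
by rewrite cardv in cardv'; card_lia.
Qed.

Lemma adj_upper v w : #|val v| = k.+1 -> adj v w ->
  exists2 x, x \in val v & val w = val v :\ x.
Proof.
move=> cardv /orP[/properU1[cardv' _ _] | /properU1[_ _ [x nwx ->]]].
  by rewrite cardv in cardv'; card_lia.
by exists x; rewrite ?setU11 ?setU1K.
Qed.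

Definition family_of (V : {set G}) S : Prop := exists2 v, v \in V & val v = S.

(** Adding to (or removing from) a set two distinct elements gives two distinct
    neighbours. *)
Lemma family_of_closed V : vertex_step 2 V \subset V ->
  closed_family k (family_of V).
Proof.
rewrite subUset => /andP[_ /subsetP closedV].
suff two v u w : u \in V -> w \in V -> u != w -> adj v u -> adj v w -> v \in V.
  split=> [S x y cardS nSx nSy neq_xy _ _ _ | S x y cardS Sx Sy neq_xy _ _ _].
    move=> [u Vu def_u] [w Vw def_w].
    have [|v def_v] := @ex_vertex S; first by rewrite /middle cardS eqxx.
    exists v => //; apply: (two v u w) => //; last 2 first.
    - by apply: (@adj_setU1 _ _ x); rewrite def_v.
    - by apply: (@adj_setU1 _ _ y); rewrite def_v.
    apply: contraNneq neq_xy => eq_uw; apply/eqP/(setU1_inj nSx).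
    by rewrite -def_u -def_w eq_uw.
  move=> [u Vu def_u] [w Vw def_w].
  have [|v def_v] := @ex_vertex S; first by rewrite /middle cardS eqxx orbT.
  exists v => //; apply: (two v u w) => //; last 2 first.
  - by apply: (@adj_setD1 _ _ x); rewrite def_v.
  - by apply: (@adj_setD1 _ _ y); rewrite def_v.
  apply: contraNneq neq_xy => eq_uw; apply/eqP/(setD1_inj Sx).
  by rewrite -def_u -def_w eq_uw.
move=> Vu Vw neq_uw vu vw; apply: closedV; rewrite inE; apply/card_gt1P.
by exists u, w; rewrite !inE Vu Vw vu vw.
Qed.

Lemma family_ofT V : all_middle k set0 setT (family_of V) -> V = setT.
Proof.
move=> allV; apply/setP=> v; rewrite inE.
have [|||u Vu /val_inj <- //] := allV (val v); rewrite ?sub0set ?subsetT //.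
exact: vertex_middle.
Qed.

Lemma degree_ge2 v : 2 <= #|[set w | adj v w]|.
Proof.
have /orP[/eqP cardv|/eqP cardv] := vertex_middle v.
  have /card_gt1P[x [y []]] : 1 < #|~: val v|.
    by have := cardsC (val v); rewrite card_ground cardv; card_lia.
  rewrite !inE => nvx nvy neq_xy; apply/card_gt1P.
  have mid z : z \notin val v -> middle k (z |: val v).
    by move=> nvz; rewrite /middle (cardsU1_eq cardv nvz) eqxx orbT.
  have [u def_u] := ex_vertex (mid x nvx).
  have [w def_w] := ex_vertex (mid y nvy).
  exists u, w; rewrite !inE (adj_setU1 nvx def_u) (adj_setU1 nvy def_w).
  split=> //; apply: contraNneq neq_xy => eq_uw; apply/eqP/(setU1_inj nvx).
  by rewrite -def_u -def_w eq_uw.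
have /card_gt1P[x [y [vx vy neq_xy]]] : 1 < #|val v| by rewrite cardv.
have mid z : z \in val v -> middle k (val v :\ z).
  by move=> vz; rewrite /middle (cardsD1_eq cardv vz) eqxx.
have [u def_u] := ex_vertex (mid x vx).
have [w def_w] := ex_vertex (mid y vy).
apply/card_gt1P; exists u, w.
rewrite !inE (adj_setD1 vx def_u) (adj_setD1 vy def_w).
split=> //; apply: contraNneq neq_xy => eq_uw; apply/eqP/(setD1_inj vx).
by rewrite -def_u -def_w eq_uw.
Qed.

Definition vertices_in (A : seq {set ground}) : {set G} := [set v | val v \in A].

Lemma card_vertices_in A : #|vertices_in A| <= size A.
Proof.
rewrite -(card_imset _ val_inj) (leq_trans _ (card_size A)) //.
by apply/subset_leq_card/subsetP=> _ /imsetP[v + ->]; rewrite inE.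
Qed.

Lemma family_of_seeds A (V : {set G}) : vertices_in A \subset V ->
  (forall S, S \in A -> middle k S) -> forall S, S \in A -> family_of V S.
Proof.
move=> sAV midA S AS; have [v def_v] := ex_vertex (midA S AS).
by exists v => //; apply: (subsetP sAV); rewrite inE def_v.
Qed.

(** The top case of [percolating_seeds], in terms of the graph; the half vertex [v]
    needs an activation only through the neighbour [w]. *)
Lemma seedsP : exists (A : seq {set ground}) v w, [/\ #|val v| = k, adj v w,
  2 * size A + ~~ odd k = k.+1 ^ 2 + 2 &
  forall V : {set G}, vertices_in A \subset V -> vertex_step 2 V \subset V ->
    odd k \/ (w \in V -> v \in V) -> V = setT].
Proof.
have [||A [S [x [[midA cardS nSx _ _] sizeA spanA]]]] :=
  @percolating_seeds _ k k _ _ card_ground (sub0set [set: ground]).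
- by rewrite cards0.
- by rewrite cardsT card_ground; card_lia.
have [|v def_v] := @ex_vertex S; first by rewrite /middle cardS eqxx.
have [|w def_w] := @ex_vertex (x |: S).
  by rewrite /middle (cardsU1_eq cardS nSx) eqxx orbT.
exists A, v, w; split=> //; first by rewrite def_v.
  by apply: (@adj_setU1 _ _ x); rewrite def_v.
move=> V sAV closedV half; apply: family_ofT; apply: spanA.
- exact: family_of_closed.
- exact: family_of_seeds.
case: half => [|half]; [by left | right=> -[u Vu def_u]].
exists v => //; apply: half; rewrite -(_ : u = w) //.
by apply: val_inj; rewrite def_w.
Qed.

(** The half vertex costs one whole vertex. *)
Lemma m_upper : m G 2 <= uphalf (k ^ 2 + 2 * k + 3).
Proof.
have [A [v [w [_ _ sizeA spanA]]]] := seedsP.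
have [_ min_m] := m_spec G 2.
pose V0 := vertices_in A :|: (if odd k then set0 else [set v]).
apply: leq_trans (min_m V0 _) _.
  apply/vertex_percolatingP=> V; rewrite subUset => /andP[sAV sV] closedV.
  apply: spanA sAV closedV _; move: sV; case: (odd k) => [|sV]; first by left.
  by right=> _; rewrite -sub1set.
have : #|V0| <= size A + ~~ odd k.
  apply: leq_trans (leq_card_setU _ _) _; apply: leq_add (card_vertices_in A) _.
  by case: (odd k); rewrite ?cards0 ?cards1.
by move/leq_trans; apply; move: sizeA; case: (odd k); card_lia.
Qed.

(** Two edges at each seed activate the seeds.  The half vertex [v] costs one edge
    [[set v; w']], taken different from the edge to [w], so that the activation of
    [w] gives a second active edge at [v]. *)
Lemma m_e_upper : m_e G 2 <= k ^ 2 + 2 * k + 3.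
Proof.
have [A [v [w [cardv vw sizeA spanA]]]] := seedsP.
have [_ min_m] := m_e_spec G 2.
have [E0 [sE0 cardE0 degE0]] := star_cover (vertices_in A) degree_ge2.
have [w' [vw' neq_w]] : exists w', adj v w' /\ w' != w.
  have /card_gt1P[w1 [w2 []]] := degree_ge2 v; rewrite !inE => vw1 vw2 neq_w.
  have [eq_w1|] := eqVneq w1 w; last by exists w1.
  by exists w2; rewrite eq_sym -eq_w1.
pose E1 := E0 :|: (if odd k then set0 else [set [set v; w']]).
apply: leq_trans (min_m E1 _) _.
  have sE1 : E1 \subset edges G.
    rewrite subUset sE0; case: (odd k); rewrite ?sub0set // sub1set.
    by have := mem_star vw'; rewrite inE => /andP[].
  apply/edge_percolatingP => // E; rewrite subUset => /andP[sE0E sE1E] sEG closedE.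
  apply/saturatedT/spanA => //; first 2 last.
  - move: sE1E; case: (odd k) => [|sE1E]; [by left | right].
    have Evw' : [set v; w'] \in E by rewrite -sub1set.
    rewrite inE => /subsetP sw; apply: saturated_degree closedE _.
    apply/card_gt1P; exists [set v; w], [set v; w'].
    split; last by apply: contraNneq neq_w => /(edge_set2_inj vw) ->.
      by rewrite inE set21 andbT setUC sw // mem_star // adj_sym.
    by rewrite inE set21 Evw'.
  - apply/subsetP=> u /degE0 du; apply: saturated_degree closedE _.
    apply: leq_trans du _; apply/subset_leq_card/subsetP=> e.
    by rewrite !inE => /andP[/(subsetP sE0E) -> ->].
  exact: saturated_closed.
have : #|E1| <= 2 * size A + ~~ odd k.
  apply: leq_trans (leq_card_setU _ _) _; apply: leq_add.
    by apply: leq_trans cardE0 _; rewrite leq_mul2l card_vertices_in.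
  by case: (odd k); rewrite ?cards0 ?cards1.
by rewrite sizeA => /leq_trans; apply; card_lia.
Qed.

Section Weights.

Import GRing.Theory Num.Theory.
Local Open Scope ring_scope.

Let node (x : ground) : rat := (nat_of_ord x)%:R.

Let inj_node : injective node.
Proof. by move=> x y /eqP; rewrite eqr_nat => /eqP/val_inj. Qed.

(** For an edge between [S] and the larger set [T] the union and the intersection of
    its two endpoints are [T] and [S], so that the weight does not depend on an
    order of the endpoints. *)
Definition edge_weight (e : {set G}) : 'M[rat]_k.+2 :=
  tensor k.+2 (node_poly node (\bigcup_(v in e) val v))
              (node_poly node (~: \bigcap_(v in e) val v)).

Lemma edge_weightE v w : val v \proper val w ->
  edge_weight [set v; w] =
    tensor k.+2 (node_poly node (val w)) (node_poly node (~: val v)).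
Proof.
move=> vw; have neq_vw : v \notin [set w].
  by rewrite inE; apply: contraTneq vw => ->; rewrite properxx.
rewrite /edge_weight !big_setU1 //= !big_set1.
by rewrite (setUidPr (proper_sub vw)) (setIidPl (proper_sub vw)).
Qed.

Lemma star_other v e : e \in star v -> exists2 w, adj v w & e = [set v; w].
Proof.
rewrite inE => /andP[/edgesP[x [y [xy ->]]]].
rewrite !inE => /orP[]/eqP->; first by exists y.
by exists x; rewrite 1?adj_sym // setUC.
Qed.

(** At a lower vertex only the factor in [y] varies, at an upper vertex only the
    factor in [z], each time by a linear polynomial with a different root for each
    neighbour. *)
Lemma edge_weight_pencil v (E : {set {set G}}) e :
    E \subset star v -> (2 <= #|E|)%N -> e \in star v ->
  edge_weight e \in <<[seq edge_weight f | f <- enum E]>>%VS.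
Proof.
move=> sE /card_gt1P[e1 [e2 [Ee1 Ee2 neq_e]]] /star_other[w vw ->{e}].
set X := <<_>>%VS.
have XE f : f \in E -> edge_weight f \in X.
  by move=> Ef; rewrite memv_span // map_f // mem_enum.
have [[w1 vw1 def_e1] [w2 vw2 def_e2]] :=
  (star_other (subsetP sE _ Ee1), star_other (subsetP sE _ Ee2)).
have neq_w : w1 != w2.
  by apply: contraNneq neq_e => eq_w; rewrite def_e1 eq_w -def_e2.
move: (XE _ Ee1) (XE _ Ee2); rewrite def_e1 def_e2 => Xe1 Xe2.
have /orP[/eqP cardv|/eqP cardv] := vertex_middle v.
  have weightE x u : x \notin val v -> val u = x |: val v ->
      edge_weight [set v; u] =
      tensor k.+2 (('X - (node x)%:P) * node_poly node (val v))
        (node_poly node (~: val v)).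
    move=> nvx def_u; rewrite edge_weightE ?(proper_setU1 nvx) //.
    by rewrite def_u node_polyU1.
  have [x nvx def_w] := adj_lower cardv vw.
  have [x1 nvx1 def_w1] := adj_lower cardv vw1.
  have [x2 nvx2 def_w2] := adj_lower cardv vw2.
  have neq_x : node x1 != node x2.
    rewrite (inj_eq inj_node); apply: contraNneq neq_w => eq_x.
    by apply/eqP/val_inj; rewrite def_w1 eq_x -def_w2.
  rewrite (weightE x) //.
  rewrite (weightE x1) // in Xe1; rewrite (weightE x2) // in Xe2.
  by have [_] := pencil_l neq_x Xe1 Xe2.
have weightE x u : x \in val v -> val u = val v :\ x ->
    edge_weight [set v; u] = tensor k.+2 (node_poly node (val v))
      (('X - (node x)%:P) * node_poly node (~: val v)).
  move=> vx def_u; rewrite setUC edge_weightE def_u ?properD1 //.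
  by rewrite setCD setUC node_polyU1 // inE vx.
have [x vx def_w] := adj_upper cardv vw.
have [x1 vx1 def_w1] := adj_upper cardv vw1.
have [x2 vx2 def_w2] := adj_upper cardv vw2.
have neq_x : node x1 != node x2.
  rewrite (inj_eq inj_node); apply: contraNneq neq_w => eq_x.
  by apply/eqP/val_inj; rewrite def_w1 eq_x -def_w2.
rewrite (weightE x) //.
rewrite (weightE x1) // in Xe1; rewrite (weightE x2) // in Xe2.
by have [_] := pencil_r neq_x Xe1 Xe2.
Qed.

Lemma m_e_lower : (k ^ 2 + 2 * k + 3 <= m_e G 2)%N.
Proof.
have [[E0 percE0 <-] _] := m_e_spec G 2.
have [X dimX weightX] := edge_percolating_span edge_weight_pencil percE0.
apply: leq_trans dimX.
suff : (k.+1 ^ 2 + 2 <= \dim X)%N by card_lia.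
apply: (@tensors_rank _ _ node inj_node _ X (fun i => (2 * k + 1 + i)%N%:R)) => //.
- exact: card_ground.
- by move=> i j /eqP; rewrite eqr_nat eqn_add2l => /eqP/val_inj.
- by move=> i x; rewrite eqr_nat; have := ltn_ord x; card_lia.
move=> S x cardS nSx.
have [|v def_v] := @ex_vertex S; first by rewrite /middle cardS eqxx.
have [|w def_w] := @ex_vertex (x |: S).
  by rewrite /middle (cardsU1_eq cardS nSx) eqxx orbT.
rewrite -def_w -def_v -edge_weightE.
  apply: weightX; apply/edgesP; exists v, w; split=> //.
  by apply: (@adj_setU1 _ _ x); rewrite def_v.
by apply: (@proper_setU1 _ _ x); rewrite def_v.
Qed.

End Weights.

End BipartiteOddGraph.

Theorem theorem1p1 (k : nat) (hk : 0 < k) :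
  m_e (bipartite_odd_graph k) 2 = k ^ 2 + 2 * k + 3 /\
  m (bipartite_odd_graph k) 2 = uphalf (k ^ 2 + 2 * k + 3).
Proof.
have m_eE : m_e (bipartite_odd_graph k) 2 = k ^ 2 + 2 * k + 3.
  by apply/eqP; rewrite eqn_leq m_e_upper ?m_e_lower.
split=> //; apply/eqP; rewrite eqn_leq m_upper //=.
have := m_e_le_rm (degree_ge2 hk); rewrite m_eE; card_lia.
Qed.
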